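(* Let $\mathbf S$ be a flip-swap language of binary strings of length $n$. When $\mathbf S$ is listed in BRGC order, the resulting listing is a $2$-Gray code. If $\mathbf S$ includes $0^n$, then the listing is cyclic.
   Context: A flip-swap language (with respect to $1$) is a set $\mathbf S$ of binary strings of length $n$ such that $\mathbf S\cup\{0^n\}$ is closed under the following two operations, whenever applicable: (1) flip (complement) the leftmost $1$; (2) swap the leftmost $1$ with the bit immediately to its right (applicable when the leftmost $1$ exists and is not in the last position). BRGC order on binary strings of length $n$ is the order of the listing $BRGC(n)$ defined recursively by $BRGC(1)=0,1$ and, for $n>1$, $BRGC(n)=BRGC(n-1)\cdot 0,\ \overline{BRGC}(n-1)\cdot 1$, where $\overline{BRGC}(m)$ is the listing $BRGC(m)$ in reverse order and $\mathcal L\cdot x$ is the listing $\mathcal L$ with the character $x$ appended to the end of each string. Listing $\mathbf S$ in BRGC order means listing its elements in the relative order in which they appear in $BRGC(n)$. A listing is a $2$-Gray code if consecutive strings differ in at most two bit positions; it is cyclic if the last and first strings also differ in at most two bit positions. *)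

(* Defs.v *)
From mathcomp Require Import all_boot perm.

Set Implicit Arguments.
Unset Strict Implicit.
Unset Printing Implicit Defensive.

(* Binary strings of length n are n.-tuple bool, with 1 = true, 0 = false;
   index 0 is the leftmost position. *)

Definition zeros n : n.-tuple bool := nseq_tuple n false.

Definition leftmost1 n (s : n.-tuple bool) (i : 'I_n) : bool :=
  tnth s i && [forall j : 'I_n, (j < i) ==> ~~ tnth s j].

Definition flip_bit n (s : n.-tuple bool) (i : 'I_n) : n.-tuple bool :=
  [tuple if k == i then ~~ tnth s k else tnth s k | k < n].

Definition swap_bits n (s : n.-tuple bool) (i j : 'I_n) : n.-tuple bool :=
  [tuple tnth s (tperm i j k) | k < n].

(* In the second clause, such a j exists exactly when the leftmost 1 is not in
   the last position. *)
Definition flip_swap_language n (S : {set n.-tuple bool}) : Prop :=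
  let T := zeros n |: S in
  (forall (s : n.-tuple bool) (i : 'I_n),
     s \in T -> leftmost1 s i -> flip_bit s i \in T) /\
  (forall (s : n.-tuple bool) (i j : 'I_n),
     s \in T -> leftmost1 s i -> j = i.+1 :> nat -> swap_bits s i j \in T).

(* The recursion starts at length 0, with the empty string alone; at length 1
   it yields the usual base case 0, 1 (see BRGC1). *)
Fixpoint BRGC (n : nat) : seq (n.-tuple bool) :=
  match n return seq (n.-tuple bool) with
  | 0 => [:: [tuple]]
  | m.+1 => [seq rcons_tuple s false | s <- BRGC m] ++
            [seq rcons_tuple s true | s <- rev (BRGC m)]
  end.

Lemma BRGC1 : BRGC 1 = [:: [tuple false]; [tuple true]].
Proof. by congr [:: _; _]; apply: val_inj. Qed.

Lemma mem_BRGC n (s : n.-tuple bool) : s \in BRGC n.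
Proof.
elim: n s => [s|n IHn s]; first by rewrite tuple0.
have [t [b ->]] : exists t : n.-tuple bool, exists b,
    s = rcons_tuple t b.
  case: s => s; case/lastP: s => [//|s b] sz_s.
  have sz_t : size s == n by rewrite size_rcons eqSS in sz_s.
  by exists (Tuple sz_t), b; apply: val_inj.
rewrite /= mem_cat; apply/orP.
by case: b; [right | left]; apply/mapP; exists t; rewrite ?mem_rev ?IHn.
Qed.

Lemma BRGC_uniq n : uniq (BRGC n).
Proof.
have inj_rcons m b :
    injective (fun t : m.-tuple bool => rcons_tuple t b).
  by move=> t u /(congr1 val)/rcons_inj[/val_inj].
elim: n => [//|n IHn] /=.
rewrite cat_uniq !map_inj_uniq ?rev_uniq ?IHn; try exact: inj_rcons.
rewrite /= andbT; apply/hasPn => _ /mapP[t _ ->]; apply/mapP => -[u _].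
by move=> /(congr1 val)/rcons_inj[].
Qed.

Definition BRGC_listing n (S : {set n.-tuple bool}) : seq (n.-tuple bool) :=
  [seq s <- BRGC n | s \in S].

Lemma perm_BRGC_listing n (S : {set n.-tuple bool}) :
  perm_eq (BRGC_listing S) (enum S).
Proof.
apply: uniq_perm => [||s]; last by rewrite mem_filter mem_BRGC andbT mem_enum.
  exact: filter_uniq (BRGC_uniq n).
exact: enum_uniq.
Qed.

Definition differ_le2 n (s t : n.-tuple bool) : bool :=
  #|[set i : 'I_n | tnth s i != tnth t i]| <= 2.

Definition two_Gray_code n (L : seq (n.-tuple bool)) : bool :=
  sorted (@differ_le2 n) L.

Definition cyclic_two_Gray_code n (L : seq (n.-tuple bool)) : bool :=
  path.cycle (@differ_le2 n) L.

(* Main.v *)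
(** A flip-swap language [T] containing [0^n] splits, by the last bit, into two
    languages of the same kind (the second one possibly empty), whose listings
    follow one another, the second one reversed.  Such a listing starts with
    [0^n]. It ends with [0^n] or [0^(n-1) 1], because flips and swaps turn any
    nonzero string of [T] into [0^(n-1) 1].  Hence the two strings at the
    junction agree except possibly in the last two positions, and the last
    string is adjacent to the first one.  If [S] lacks [0^n], its listing is
    that of [S] with [0^n] added, minus the first string. *)

Require Import Defs.
From mathcomp Require Import all_boot perm.

Set Implicit Arguments.
Unset Strict Implicit.
Unset Printing Implicit Defensive.

Lemma tnth_rcons_widen n (s : n.-tuple bool) b (i : 'I_n) :
  tnth (rcons_tuple s b) (widen_ord (leqnSn n) i) = tnth s i.
Proof. by rewrite !(tnth_nth false) /= nth_rcons size_tuple ltn_ord. Qed.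

Lemma tnth_rcons_max n (s : n.-tuple bool) b :
  tnth (rcons_tuple s b) ord_max = b.
Proof. by rewrite (tnth_nth false) /= nth_rcons size_tuple ltnn eqxx. Qed.

Lemma ord_widenP n (P : 'I_n.+1 -> Prop) :
  (forall i : 'I_n, P (widen_ord (leqnSn n) i)) -> P ord_max ->
  forall i, P i.
Proof.
move=> Pw Pm i; have [i_lt|i_ge] := ltnP i n.
  by rewrite (_ : i = widen_ord (leqnSn n) (Ordinal i_lt)) //; apply: val_inj.
rewrite (_ : i = ord_max) //; apply: val_inj; apply/eqP.
by rewrite eqn_leq i_ge -ltnS ltn_ord.
Qed.

Lemma eq_rcons_tuple n (s : n.-tuple bool) b (t : n.+1.-tuple bool) :
  (forall i, tnth t (widen_ord (leqnSn n) i) = tnth s i) ->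
  tnth t ord_max = b -> t = rcons_tuple s b.
Proof.
move=> tw tm; apply: eq_from_tnth; apply: ord_widenP => [i|].
  by rewrite tnth_rcons_widen.
by rewrite tnth_rcons_max.
Qed.

Lemma tnth_zeros n (i : 'I_n) : tnth (zeros n) i = false.
Proof. by rewrite (tnth_nth false) /= nth_nseq ltn_ord. Qed.

Lemma zerosS n : zeros n.+1 = rcons_tuple (zeros n) false.
Proof. by apply: eq_rcons_tuple => [i|]; rewrite !tnth_zeros. Qed.

Lemma leftmost1_ex n (s : n.-tuple bool) :
  s != zeros n -> exists i, leftmost1 s i.
Proof.
move=> s_neq0; have [i0 si0] : exists i, tnth s i.
  apply/existsP; apply: contraR s_neq0 => /existsPn s0.
  by apply/eqP/eq_from_tnth => i; rewrite tnth_zeros; apply: negbTE.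
case: (arg_minnP (P := fun i => tnth s i) val si0) => i si i_min.
exists i; rewrite /leftmost1 si; apply/forallP => j; apply/implyP.
by rewrite ltnNge; apply/contra/i_min.
Qed.

Lemma leftmost1_rcons n (s : n.-tuple bool) b (i : 'I_n) :
  leftmost1 s i -> leftmost1 (rcons_tuple s b) (widen_ord (leqnSn n) i).
Proof.
case/andP=> si /forallP s_lt; rewrite /leftmost1 tnth_rcons_widen si /=.
apply/forallP; apply: ord_widenP => [j|]; last by rewrite ltnNge ltnW.
by rewrite tnth_rcons_widen; exact: s_lt.
Qed.

Lemma flip_bit_rcons n (s : n.-tuple bool) b (i : 'I_n) :
  flip_bit (rcons_tuple s b) (widen_ord (leqnSn n) i) =
    rcons_tuple (flip_bit s i) b.
Proof.
apply: eq_rcons_tuple => [k|]; rewrite !tnth_mktuple.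
  by rewrite tnth_rcons_widen.
by rewrite tnth_rcons_max -val_eqE /= gtn_eqF.
Qed.

Lemma swap_bits_rcons n (s : n.-tuple bool) b (i j : 'I_n) :
  swap_bits (rcons_tuple s b) (widen_ord (leqnSn n) i)
    (widen_ord (leqnSn n) j) = rcons_tuple (swap_bits s i j) b.
Proof.
have winj : injective (widen_ord (leqnSn n)).
  by move=> x y /(congr1 val)/=/val_inj.
apply: eq_rcons_tuple => [k|]; rewrite !tnth_mktuple.
  by rewrite -inj_tperm // tnth_rcons_widen.
by rewrite tpermD ?tnth_rcons_max // -val_eqE /= ltn_eqF.
Qed.

(** Closure of the set itself, with [zeros n] not adjoined: the induction passes to sections by the
    last bit, and the section for 1 may be empty. *)
Definition flip_swap_closed n (T : {set n.-tuple bool}) : Prop :=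
  (forall (s : n.-tuple bool) (i : 'I_n),
     s \in T -> leftmost1 s i -> flip_bit s i \in T) /\
  (forall (s : n.-tuple bool) (i j : 'I_n),
     s \in T -> leftmost1 s i -> j = i.+1 :> nat -> swap_bits s i j \in T).

(** Each flip of the leftmost 1 lowers the number of 1s, so repeated flips end at [zeros n]. *)
Lemma zeros_flip_swap_closed n (T : {set n.-tuple bool}) s :
  flip_swap_closed T -> s \in T -> zeros n \in T.
Proof.
case=> Tflip _; have [m] := ubnP #|[set i | tnth s i]|.
elim: m s => // m IHm s s_lt Ts.
have [<- //|/leftmost1_ex [i i_left]] := eqVneq s (zeros n).
apply: (IHm (flip_bit s i)); last exact: Tflip.
rewrite ltnS in s_lt; apply: leq_trans s_lt; apply: proper_card.
have si : tnth s i by case/andP: i_left.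
apply/properP; split; last first.
  by exists i; rewrite !inE // tnth_mktuple eqxx si.
apply/subsetP => k; rewrite !inE tnth_mktuple.
by case: eqP => // ->; rewrite si.
Qed.

Definition last_bit_section n (T : {set n.+1.-tuple bool}) b :
  {set n.-tuple bool} := [set s | rcons_tuple s b \in T].

(** The leftmost 1 of [s] is still the leftmost one after a bit is appended, and operations inside
    [s] leave the appended bit alone. *)
Lemma last_bit_section_closed n (T : {set n.+1.-tuple bool}) b :
  flip_swap_closed T -> flip_swap_closed (last_bit_section T b).
Proof.
case=> Tflip Tswap; split=> [s i|s i j]; rewrite !inE.
  by move=> Ts /(leftmost1_rcons b); rewrite -flip_bit_rcons; apply: Tflip.
move=> Ts /(leftmost1_rcons b) i_left ji.
by rewrite -swap_bits_rcons; apply: Tswap.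
Qed.

(** Filtering commutes with appending a bit and with reversal, so the recursion of [BRGC] carries
    over to listings. *)
Lemma BRGC_listing_rcons n (T : {set n.+1.-tuple bool}) :
  BRGC_listing T =
    [seq rcons_tuple s false | s <- BRGC_listing (last_bit_section T false)] ++
    [seq rcons_tuple s true | s <- rev (BRGC_listing (last_bit_section T true))].
Proof.
rewrite /BRGC_listing /= filter_cat !filter_map -filter_rev.
by congr (_ ++ _); congr map; apply: eq_filter => s; rewrite /= inE.
Qed.

(** A sum rather than a cardinal, so that the contribution of the last bit splits off. *)
Definition hamming n (s t : n.-tuple bool) : nat :=
  \sum_(i < n) (tnth s i != tnth t i).

Lemma differ_le2E n (s t : n.-tuple bool) : differ_le2 s t = (hamming s t <= 2).
Proof.
rewrite /differ_le2 /hamming -sum1_card big_mkcond /=; congr (_ <= _).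
by apply: eq_bigr => i _; rewrite inE; case: (_ != _).
Qed.

Lemma hamming_rcons n (s t : n.-tuple bool) b c :
  hamming (rcons_tuple s b) (rcons_tuple t c) = hamming s t + (b != c).
Proof.
rewrite /hamming big_ord_recr /= !tnth_rcons_max; congr (_ + _).
by apply: eq_bigr => i _; rewrite !tnth_rcons_widen.
Qed.

Lemma differ_le2C n : symmetric (@differ_le2 n).
Proof.
by move=> s t; congr (_ <= _); apply: eq_card => i; rewrite !inE eq_sym.
Qed.

(** Describes the strings 0^n and 0^(n-1) 1 without treating length 0 separately. *)
Definition last_only n (s : n.-tuple bool) : Prop :=
  forall i : 'I_n, tnth s i -> i.+1 = n.

Lemma last_only_zeros n : last_only (zeros n).
Proof. by move=> i; rewrite tnth_zeros. Qed.

Lemma last_only_rcons_zeros n b : last_only (rcons_tuple (zeros n) b).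
Proof.
apply: ord_widenP => // i.
by rewrite tnth_rcons_widen tnth_zeros.
Qed.

Lemma hamming_last_only n (s t : n.-tuple bool) :
  last_only s -> last_only t -> hamming s t <= 1.
Proof.
case: n s t => [|n] s t s_last t_last; first by rewrite /hamming big_ord0.
rewrite /hamming big_ord_recr /= big1 ?leq_b1 // => i _.
have w_max (u : n.+1.-tuple bool) : last_only u ->
    tnth u (widen_ord (leqnSn n) i) = false.
  move=> u_last; apply/negP => /u_last [/eqP].
  by rewrite /= ltn_eqF.
by rewrite !w_max.
Qed.

(** Both ends are tracked for the induction: the junction joins the last strings of the two
    sublistings, and reversal moves the first string of the second one to the end. *)
Lemma BRGC_listing_path n (T : {set n.-tuple bool}) :
  flip_swap_closed T -> zeros n \in T ->
  exists r, [/\ BRGC_listing T = zeros n :: r,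
    path (@differ_le2 n) (zeros n) r & last_only (last (zeros n) r)].
Proof.
elim: n T => [|n IHn] T Tfs T0.
  exists [::]; split => //; last by case.
  by rewrite /BRGC_listing /= -(tuple0 (zeros 0)) T0.
have path_rcons b x p : path (@differ_le2 n) x p ->
    path (@differ_le2 n.+1) (rcons_tuple x b)
      [seq rcons_tuple s b | s <- p].
  apply: (homo_path (f := fun s => rcons_tuple s b)) => u v.
  by rewrite !differ_le2E hamming_rcons eqxx addn0.
have [||r0 [L0 path0 last0]] := IHn (last_bit_section T false).
- exact: last_bit_section_closed.
- by rewrite inE -zerosS.
rewrite BRGC_listing_rcons L0 map_cons -zerosS.
have [T1_0|[s1 Ts1]] := set_0Vmem (last_bit_section T true).
  rewrite T1_0 /BRGC_listing (eq_filter (a2 := pred0)); last first.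
    by move=> s; rewrite inE.
  rewrite filter_pred0 cats0; exists [seq rcons_tuple s false | s <- r0].
  split=> //; first by rewrite zerosS; apply: path_rcons.
  rewrite zerosS (last_map (fun s => rcons_tuple s false)); set u := last _ _ in last0 *.
  suff -> : u = zeros n by apply: last_only_rcons_zeros.
  (* Otherwise [last0] puts the leftmost 1 of [u] in its last position; swapping it with the
     appended 0 gives a string of [T] that ends in 1, although the section for 1 is empty. *)
  apply/eqP/negPn/negP => /leftmost1_ex [i i_left].
  have ui : tnth u i by case/andP: i_left.
  have Tu : rcons_tuple u false \in T.
    have : u \in BRGC_listing (last_bit_section T false).
      by rewrite L0 mem_last.
    by rewrite mem_filter inE => /andP[].
  have := Tfs.2 _ _ ord_max Tu (leftmost1_rcons false i_left)
    (esym (last0 i ui)).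
  set v := swap_bits _ _ _.
  suff -> : v = rcons_tuple [tuple tnth v (widen_ord (leqnSn n) k) | k < n] true.
    move=> Tv; have := in_set0 [tuple tnth v (widen_ord (leqnSn n) k) | k < n].
    by rewrite -T1_0 inE Tv.
  apply: eq_rcons_tuple => [k|]; first by rewrite tnth_mktuple.
  by rewrite tnth_mktuple tpermR tnth_rcons_widen.
have T1fs := last_bit_section_closed true Tfs.
have [||r1 [L1 path1 last1]] := IHn (last_bit_section T true) => //.
  exact: zeros_flip_swap_closed T1fs Ts1.
rewrite L1; eexists; split; first by [].
- rewrite cat_path zerosS path_rcons //=
    (last_map (fun s => rcons_tuple s false)).
  (* The reversed half begins with the last string of [L1]. At the junction the prefixes differ in
     at most one position, and the appended bits add one more. *)
  rewrite lastI rev_rcons /= differ_le2E hamming_rcons.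
  rewrite (leq_add (hamming_last_only last0 last1)) //=.
  apply: path_rcons; rewrite rev_path.
  by apply: sub_path path1 => x y; rewrite differ_le2C.
(* The head [zeros n] of the second sublisting comes last after reversal, followed by the bit 1. *)
- rewrite last_cat rev_cons map_rcons last_rcons.
  exact: last_only_rcons_zeros.
Qed.

Theorem theorem2 (n : nat) (n_gt0 : 0 < n) (S : {set n.-tuple bool})
    (S_flip_swap : flip_swap_language S) :
  two_Gray_code (BRGC_listing S) /\
  (zeros n \in S -> cyclic_two_Gray_code (BRGC_listing S)).
Proof.
have [||r [Lr path_r last_r]] := @BRGC_listing_path n (zeros n |: S).
- exact: S_flip_swap.
- exact: setU11.
have [S0|S0] := boolP (zeros n \in S).
  move: Lr; rewrite (setUidPr _) ?sub1set // => Lr.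
  rewrite /two_Gray_code /cyclic_two_Gray_code Lr; split=> // _.
  rewrite /= rcons_path path_r differ_le2E.
  exact: leqW (hamming_last_only last_r (@last_only_zeros n)).
split=> //; rewrite /two_Gray_code.
suff -> : BRGC_listing S = r by apply: path_sorted path_r.
(* By uniqueness [zeros n] does not recur in [r], so filtering it out removes the head only. *)
have /andP[r0 _] : uniq (zeros n :: r) by rewrite -Lr filter_uniq ?BRGC_uniq.
have -> : BRGC_listing S = [seq s <- BRGC_listing (zeros n |: S) | s != zeros n].
  rewrite -filter_predI; apply: eq_filter => s /=; rewrite !inE.
  by have [->|] := eqVneq s; rewrite ?(negbTE S0).
rewrite Lr /= eqxx; apply/all_filterP/allP => s rs.
by apply: contraNneq r0 => <-.
Qed.
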